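(* Let $w\in\{b_2,b_{1,1}\}$ and let $d$ be the length of $w$ ($d=3$ for $b_2$, $d=4$ for $b_{1,1}$). Then for all $x\in[-\pi,\pi)^d$, $$d(x;w)=\min_{k\in\mathbb Z}|\Delta(x;w)+2\pi k|=\big|\big(\Delta(x;w)\big)_{2\pi}\big|.$$
   Context: For $t\in\mathbb R$, $(t)_{2\pi}$ is the unique point of $[-\pi,\pi)$ with $t-(t)_{2\pi}\in2\pi\mathbb Z$. $b_2=(1,-2,1)^{\mathrm T}$, $b_{1,1}=(-1,1,1,-1)^{\mathrm T}$. For $w\in\mathbb R^d\setminus\{0\}$ with $\sum_j w_j=0$ put $\Delta(x;w):=\langle x,w\rangle$. The absolute cyclic difference of $x\in[-\pi,\pi)^d$ (angles representing points on the circle) with respect to $w$ is $$d(x;w):=\min_{\alpha\in\mathbb R}\big|\Delta([x+\alpha 1_d]_{2\pi};w)\big|,$$ where $1_d$ is the all-ones vector and $[\cdot]_{2\pi}$ is applied componentwise, with $[t]_{2\pi}=(t)_{2\pi}$ if $t\notin\{(2k+1)\pi:k\in\mathbb Z\}$ and $[(2k+1)\pi]_{2\pi}=\pm\pi$, i.e. both values are allowed, independently in each component, and the minimum is also taken over these choices. *)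

(* Defs.v *)
From HB Require Import structures.
From mathcomp Require Import all_boot all_order all_algebra.
From mathcomp Require Import ring lra.
From mathcomp Require Import all_classical all_reals all_analysis.

Set Implicit Arguments.
Unset Strict Implicit.
Unset Printing Implicit Defensive.

Import Order.TTheory GRing.Theory Num.Theory.
Import numFieldNormedType.Exports.

Local Open Scope classical_set_scope.
Local Open Scope ring_scope.

Definition is_min (R : realType) (A : set R) (m : R) : Prop :=
  A m /\ lbound A m.

(* The representative (t)_{2pi} of t in [-pi, pi); see [pmod2pi_itv],
   [pmod2pi_congr] and [pmod2pi_unique]. *)
Definition pmod2pi (R : realType) (t : R) : R :=
  t - (Num.floor ((t + pi) / (2 * pi)))%:~R * (2 * pi).

(* The set of admissible values of the multivalued [t]_{2pi}. *)
Definition mpmod2pi (R : realType) (t : R) : set R :=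
  [set s | if `[< exists k : int, t = (2 * k + 1)%:~R * pi >]
           then s = pi \/ s = - pi
           else s = pmod2pi t].

Definition Delta (R : realType) (d : nat) (x w : 'cV[R]_d) : R :=
  \sum_(j < d) x j 0 * w j 0.

(* All values |Delta([x + alpha 1_d]_{2pi}; w)|, over alpha and over the
   independent componentwise choices y j of [x_j + alpha]_{2pi}. *)
Definition cyc_values (R : realType) (d : nat) (x w : 'cV[R]_d) : set R :=
  [set v | exists (alpha : R) (y : 'cV[R]_d),
      (forall j, mpmod2pi (x j 0 + alpha) (y j 0)) /\ v = `|Delta y w|].

(* d(x; w).  The infimum is a minimum exactly when
   [is_min (cyc_values x w) (cyc_diff x w)]. *)
Definition cyc_diff (R : realType) (d : nat) (x w : 'cV[R]_d) : R :=
  inf (cyc_values x w).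

Definition b2 (R : realType) : 'cV[R]_3 :=
  \col_(i < 3) nth 0 [:: 1; -2; 1] i.

Definition b11 (R : realType) : 'cV[R]_4 :=
  \col_(i < 4) nth 0 [:: -1; 1; 1; -1] i.

Lemma pmod2pi_itv (R : realType) (t : R) : - pi <= pmod2pi t < pi.
Proof.
have p0 : 0 < 2 * pi :> R by rewrite mulr_gt0 ?pi_gt0.
rewrite /pmod2pi; have /andP[] := floor_itv ((t + pi) / (2 * pi)).
rewrite ler_pdivlMr // ltr_pdivrMr //; move: (Num.floor _) => k.
rewrite intrD mulrDl mul1r => h1 h2.
by apply/andP; split; lra.
Qed.

Lemma pmod2pi_congr (R : realType) (t : R) :
  exists k : int, t - pmod2pi t = k%:~R * (2 * pi).
Proof.
by exists (Num.floor ((t + pi) / (2 * pi))); rewrite /pmod2pi opprB addrC subrK.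
Qed.

Lemma pmod2pi_unique (R : realType) (t s : R) (k : int) :
  - pi <= s < pi -> t - s = k%:~R * (2 * pi) -> s = pmod2pi t.
Proof.
move=> /andP[s1 s2] tsk.
have p0 : 0 < 2 * pi :> R by rewrite mulr_gt0 ?pi_gt0.
have -> : pmod2pi t = t - k%:~R * (2 * pi).
  rewrite /pmod2pi (@floor_def _ _ k) // ler_pdivlMr // ltr_pdivrMr //.
  rewrite intrD (mulrDl k%:~R) mul1r -tsk.
  by apply/andP; split; lra.
by rewrite -tsk subKr.
Qed.

Lemma is_min_inf (R : realType) (A : set R) (m : R) : is_min A m -> inf A = m.
Proof.
move=> [Am lAm]; apply/eqP; rewrite eq_le; apply/andP; split.
  by apply: ge_inf => //; exists m.
by apply: lb_le_inf => //; exists m.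
Qed.

Lemma b2_contrast (R : realType) : b2 R != 0 /\ \sum_j b2 R j 0 = 0.
Proof.
split; last by rewrite !big_ord_recl big_ord0 !mxE /=; ring.
by apply/eqP => /matrixP/(_ 0 0); rewrite !mxE /= => /eqP; rewrite oner_eq0.
Qed.

Lemma b11_contrast (R : realType) : b11 R != 0 /\ \sum_j b11 R j 0 = 0.
Proof.
split; last by rewrite !big_ord_recl big_ord0 !mxE /=; ring.
by apply/eqP => /matrixP/(_ 0 0); rewrite !mxE /= => /eqP; rewrite oppr_eq0 oner_eq0.
Qed.

(* Main.v *)
Require Import Defs.
From HB Require Import structures.
From mathcomp Require Import all_boot all_order all_algebra.
From mathcomp Require Import ring lra zify.
From mathcomp Require Import all_classical all_reals all_analysis.
Import Order.TTheory GRing.Theory Num.Theory.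
Import numFieldNormedType.Exports.
Local Open Scope classical_set_scope.
Local Open Scope ring_scope.

(** Write [D] for [Delta _ w].  Since [w] has integer entries with sum zero,
    [D] is unchanged by a common shift of the angles, and moves by a multiple
    of [2 pi] when one angle is replaced by another representative.  So every
    competitor in the definition of [d(x; w)] has the form [|D x + 2 pi k|]
    ([eqmod2pi_Delta]), and a competitor with [|D| <= pi] is automatically the
    smallest of all these numbers ([le_norm_eqmod2pi]).  What has to be shown is
    that such a competitor exists.

    The competitors can be described without [alpha]: they are the values
    [|D z|] for which [z] lists real representatives of the angles [x] that lie
    together in a closed interval of length [2 pi] ([cyc_values_arc_lift]); the
    two choices at odd multiples of [pi] are exactly what makes the interval
    closed.  Starting from [z = x], lowering the largest [z_j] or raising the
    smallest one by [2 pi] keeps all of [z] in such an interval.  If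
    [D z > pi] and the largest entry has weight [1], or the smallest one has
    weight [-1], the move lowers [D] by exactly [2 pi], and after finitely many
    moves [-pi <= D <= pi] ([arc_lift_descend]); the case [D z < -pi] is the
    mirror image.  For both [b2] and [b11] one of these two moves is available
    whenever [D z > 0] ([steerable_b2], [steerable_b11]). *)

Section CyclicDifference.
Set Implicit Arguments.
Unset Strict Implicit.
Unset Printing Implicit Defensive.

Context {R : realType}.
Implicit Types (s t : R).

Let twopi_gt0 : 0 < 2 * pi :> R.
Proof. by rewrite mulr_gt0 ?pi_gt0. Qed.

Let twopi_neq0 : 2 * pi != 0 :> R.
Proof. exact: lt0r_neq0. Qed.

(** * Congruence modulo [2 pi] *)

Definition eqmod2pi s t := (s - t) / (2 * pi) \is a Num.int.

Lemma eqmod2piP s t :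
  reflect (exists k : int, s = t + 2 * pi * k%:~R) (eqmod2pi s t).
Proof.
rewrite /eqmod2pi; apply: (iffP intrP) => -[k]; last first.
  by move=> ->; exists k; rewrite addrAC subrr add0r mulrAC divff ?mul1r.
move=> stk; exists k; rewrite -stk mulrCA divff // mulr1.
by rewrite addrC subrK.
Qed.

Lemma eqmod2pi_refl t : eqmod2pi t t.
Proof. by rewrite /eqmod2pi subrr mul0r rpred0. Qed.

Lemma eqmod2pi_sym s t : eqmod2pi s t = eqmod2pi t s.
Proof. by rewrite /eqmod2pi -opprB mulNr rpredN. Qed.

Lemma eqmod2pi_trans t s u : eqmod2pi s t -> eqmod2pi t u -> eqmod2pi s u.
Proof.
rewrite /eqmod2pi => st tu.
by have := rpredD st tu; rewrite -mulrDl addrA subrK.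
Qed.

Lemma eqmod2piN s t : eqmod2pi (- s) (- t) = eqmod2pi s t.
Proof. by rewrite /eqmod2pi -opprD mulNr rpredN. Qed.

Lemma eqmod2piDr c s t : eqmod2pi (s + c) (t + c) = eqmod2pi s t.
Proof. by rewrite /eqmod2pi opprD addrACA subrr addr0. Qed.

Lemma eqmod2pi_pmod2pi t : eqmod2pi (pmod2pi t) t.
Proof.
rewrite eqmod2pi_sym; apply/eqmod2piP; have [k tk] := pmod2pi_congr t.
by exists k; rewrite mulrC -tk addrC subrK.
Qed.

(** A nonzero multiple of [2 pi] has absolute value at least [2 pi], hence
    brings [t] to distance at least [2 pi - pi] from the origin. *)
Lemma le_norm_eqmod2pi s t : `|t| <= pi -> eqmod2pi s t -> `|t| <= `|s|.
Proof.
move=> tpi /eqmod2piP[k ->].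
have [->|k0] := eqVneq k 0; first by rewrite mulr0 addr0.
have : 2 * pi <= `|2 * pi * k%:~R : R|.
  rewrite normrM (gtr0_norm twopi_gt0) ler_peMr ?(ltW twopi_gt0) //.
  by rewrite norm_intr_ge1 ?intr_int // intr_eq0.
have := ler_normB (t + 2 * pi * k%:~R) t; rewrite addrAC subrr add0r.
by move=> h1 h2; lra.
Qed.

Lemma mpmod2pi_eqmod2pi t s : mpmod2pi t s -> eqmod2pi s t.
Proof.
rewrite /mpmod2pi /=; case: asboolP => [[k ->]|_ ->]; last first.
  exact: eqmod2pi_pmod2pi.
case=> ->; apply/eqmod2piP.
  by exists (- k); rewrite !(intrD, intrM, intrN); ring.
by exists (- k - 1); rewrite !(intrD, intrM, intrN); ring.
Qed.

(** Both endpoints of the closed interval are reached, because [t] is an odd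
    multiple of [pi] as soon as one of them is congruent to [t]. *)
Lemma eqmod2pi_mpmod2pi t s : - pi <= s <= pi -> eqmod2pi s t -> mpmod2pi t s.
Proof.
move=> /andP[s1 s2] st; rewrite /mpmod2pi /=.
have p0 := pi_gt0 R.
case: asboolP => [[k tk]|tNodd].
  have /eqmod2piP[m sm] : eqmod2pi s pi.
    apply: eqmod2pi_trans st _; apply/eqmod2piP; exists k.
    by rewrite tk !(intrD, intrM); ring.
  have m1 : (-1 <= m)%R.
    rewrite -(ler_int R) -(ler_pM2l twopi_gt0).
    by rewrite intrN; lra.
  have m0 : (m <= 0)%R by rewrite -(ler_int R) -(ler_pM2l twopi_gt0); lra.
  have [m_eq|m_eq] : m = 0 \/ m = -1 by lia.
    by left; rewrite sm m_eq; ring.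
  by right; rewrite sm m_eq intrN; ring.
have sNpi : s != pi.
  apply/eqP => spi; apply: tNodd.
  move: st; rewrite eqmod2pi_sym => /eqmod2piP[k tk].
  by exists k; rewrite tk spi !(intrD, intrM); ring.
move: st; rewrite eqmod2pi_sym => /eqmod2piP[k tk].
apply: (@pmod2pi_unique _ _ _ k); first by rewrite s1 lt_neqAle sNpi.
by rewrite tk; ring.
Qed.

(** * Contrasts *)

Section Contrast.
Context {d : nat}.
Implicit Types (w x y z : 'cV[R]_d).

Definition int_contrast w :=
  (forall j, w j 0 \is a Num.int) /\ \sum_j w j 0 = 0.

Lemma DeltaN z w : Delta (- z) w = - Delta z w.
Proof. by rewrite /Delta -sumrN; apply: eq_bigr => j _; rewrite mxE mulNr. Qed.

Lemma Delta_add_delta_mx z w (c : R) i :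
  Delta (z + c *: delta_mx i 0) w = Delta z w + c * w i 0.
Proof.
rewrite /Delta (eq_bigr (fun j => z j 0 * w j 0 +
                                 c * (j == i)%:R * w j 0)); last first.
  by move=> j _; rewrite !mxE andbT mulrDl.
rewrite big_split /=; congr (_ + _).
rewrite (bigD1 i) //= eqxx mulr1 big1 ?addr0 //.
by move=> j /negbTE ->; rewrite mulr0 mul0r.
Qed.

Lemma eqmod2pi_Delta w x y (alpha : R) : int_contrast w ->
  (forall j, eqmod2pi (y j 0) (x j 0 + alpha)) ->
  eqmod2pi (Delta y w) (Delta x w).
Proof.
move=> [wint w0] yx.
have -> : Delta x w = \sum_j (x j 0 + alpha) * w j 0.
  under eq_bigr do rewrite mulrDl.
  by rewrite big_split /= -mulr_sumr w0 mulr0 addr0.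
rewrite /eqmod2pi /Delta -sumrB mulr_suml rpred_sum // => j _.
by rewrite -mulrBl mulrAC rpredM //; exact: yx.
Qed.

(** * Representatives in an interval of length [2 pi] *)

Definition arc_lift x z :=
  (forall j, eqmod2pi (z j 0) (x j 0)) /\
  exists a : R, forall j, a <= z j 0 <= a + 2 * pi.

Lemma arc_liftN x z : arc_lift x z -> arc_lift (- x) (- z).
Proof.
move=> [zx [a za]]; split=> [j|]; first by rewrite !mxE eqmod2piN.
exists (- a - 2 * pi) => j; have /andP[] := za j; rewrite !mxE => h1 h2.
by apply/andP; split; lra.
Qed.

(** The rotation [alpha] carries the interval to [[-pi, pi]]. *)
Lemma cyc_values_arc_lift x z w : int_contrast w -> arc_lift x z ->
  cyc_values x w `|Delta z w|.
Proof.
move=> [wint w0] [zx [a za]]; exists (- a - pi).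
exists (\col_j (z j 0 + (- a - pi))); split=> [j|].
  rewrite mxE; apply: eqmod2pi_mpmod2pi; last by rewrite eqmod2piDr.
  by have /andP[h1 h2] := za j; apply/andP; split; lra.
congr `| _ |; rewrite /Delta.
under [RHS]eq_bigr do rewrite mxE mulrDl.
by rewrite big_split /= -mulr_sumr w0 mulr0 addr0.
Qed.

Lemma arc_lift_lower_max x z i : arc_lift x z ->
  (forall j, z j 0 <= z i 0) -> arc_lift x (z + (- (2 * pi)) *: delta_mx i 0).
Proof.
move=> [zx [a za]] zi; split=> [j|].
  apply: eqmod2pi_trans (zx j); apply/eqmod2piP; exists (- (j == i)%:Z).
  by rewrite !mxE andbT intrN -pmulrn; ring.
exists (z i 0 - 2 * pi) => j; rewrite !mxE andbT.
have /andP[j1 j2] := za j; have /andP[i1 i2] := za i; have := zi j.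
have [->|_] := eqVneq j i => /= h; apply/andP; split; lra.
Qed.

Lemma arc_lift_raise_min x z i : arc_lift x z ->
  (forall j, z i 0 <= z j 0) -> arc_lift x (z + (2 * pi) *: delta_mx i 0).
Proof.
move=> /arc_liftN xz zi.
have /(arc_lift_lower_max xz)/arc_liftN : forall j, (- z) j 0 <= (- z) i 0.
  by move=> j; rewrite !mxE lerN2.
by rewrite scaleNr opprB opprK addrC opprK.
Qed.

(** The condition on the weights that lets a move at an extreme entry lower
    a positive [Delta z w] by exactly [2 pi].  Applied to [- z], it also lets
    such a move raise a negative one. *)
Definition steerable w := forall z, 0 < Delta z w ->
  (exists2 i, (forall j, z j 0 <= z i 0) & w i 0 = 1) \/
  (exists2 i, (forall j, z i 0 <= z j 0) & w i 0 = -1).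

Lemma arc_lift_descend x z w : steerable w -> arc_lift x z ->
  - pi <= Delta z w -> exists2 z', arc_lift x z' & `|Delta z' w| <= pi.
Proof.
move=> w_steer xz Dge; have p0 := pi_gt0 R.
(* [n] bounds the number of moves still needed, each lowering [Delta] by
   [2 pi]. *)
have [n Dlt] : exists n : nat, Delta z w <= (n.*2.+1)%:R * pi.
  exists (Num.bound `|Delta z w / pi|); rewrite -ler_pdivrMr //.
  apply: le_trans (ler_norm _) _; apply: ltW.
  apply: lt_le_trans (archi_boundP (normr_ge0 _)) _.
  by rewrite ler_nat -addnn leqW // leq_addl.
elim: n z xz Dge Dlt => [|n IHn] z xz Dge Dlt.
  by exists z => //; rewrite ler_norml Dge /= -[leRHS]mul1r.
have [Dle|Dgt] := lerP (Delta z w) pi.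
  by exists z => //; rewrite ler_norml Dge.
have step z' : arc_lift x z' -> Delta z' w = Delta z w - 2 * pi ->
    exists2 z', arc_lift x z' & `|Delta z' w| <= pi.
  move=> xz' Dz'; apply: (IHn z') => //; rewrite Dz'; first by lra.
  move: Dlt; rewrite doubleS -(addn2 n.*2.+1) natrD mulrDl => Dlt; lra.
have [[i zi wi]|[i zi wi]] := w_steer z (lt_trans p0 Dgt).
  by apply: step (arc_lift_lower_max xz zi) _;
     rewrite Delta_add_delta_mx wi; ring.
by apply: step (arc_lift_raise_min xz zi) _;
     rewrite Delta_add_delta_mx wi; ring.
Qed.

Lemma exists_arc_lift_small x w : steerable w ->
  (forall j, - pi <= x j 0 < pi) ->
  exists2 z, arc_lift x z & `|Delta z w| <= pi.
Proof.
move=> w_steer x_itv; have p0 := pi_gt0 R.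
have xx : arc_lift x x.
  split=> [j|]; first exact: eqmod2pi_refl.
  by exists (- pi) => j; have /andP[h1 h2] := x_itv j; apply/andP; split; lra.
have [Dge|Dlt] := lerP (- pi) (Delta x w); first exact: arc_lift_descend xx Dge.
have [|z xz zpi] := arc_lift_descend w_steer (arc_liftN xx).
  by rewrite DeltaN; lra.
exists (- z); last by rewrite DeltaN normrN.
by rewrite -[x]opprK; exact: arc_liftN.
Qed.

Lemma cyc_diff_steerable x w : int_contrast w -> steerable w ->
  (forall j, - pi <= x j 0 < pi) ->
  [/\ is_min (cyc_values x w) (cyc_diff x w),
      is_min [set `|Delta x w + 2 * pi * k%:~R| | k in [set: int]]
             (cyc_diff x w)
    & cyc_diff x w = `|pmod2pi (Delta x w)| ].
Proof.
move=> w_contrast w_steer x_itv.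
have [z xz zpi] := exists_arc_lift_small w_steer x_itv.
have Dzx : eqmod2pi (Delta z w) (Delta x w).
  apply: (eqmod2pi_Delta (alpha := 0)) => // j.
  by rewrite addr0; case: xz => + _; exact.
have z_min s : eqmod2pi s (Delta x w) -> `|Delta z w| <= `|s|.
  move=> sx; apply: le_norm_eqmod2pi => //.
  by apply: eqmod2pi_trans sx _; rewrite eqmod2pi_sym.
have cyc_min : is_min (cyc_values x w) `|Delta z w|.
  split=> [|_ [alpha [y [yx ->]]]]; first exact: cyc_values_arc_lift.
  apply: z_min; apply: (eqmod2pi_Delta (alpha := alpha)) => // j.
  exact: mpmod2pi_eqmod2pi.
have -> : cyc_diff x w = `|Delta z w| by exact: is_min_inf.
split=> //.
  split=> [|_ [k _ <-]]; last by apply: z_min; apply/eqmod2piP; exists k.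
  by have /eqmod2piP[k ->] := Dzx; exists k.
apply/eqP; rewrite eq_le z_min ?eqmod2pi_pmod2pi //=.
apply: le_norm_eqmod2pi.
  have /andP[h1 h2] := pmod2pi_itv (Delta x w).
  by rewrite ler_norml h1 ltW.
by apply: eqmod2pi_trans Dzx _; rewrite eqmod2pi_sym eqmod2pi_pmod2pi.
Qed.

End Contrast.

(** * The contrasts [b2] and [b11] *)

Lemma exists_max_entry (n : nat) (z : 'cV[R]_n.+1) :
  exists i, forall j, z j 0 <= z i 0.
Proof.
have [//|i _ zi] :=
  @Order.TotalTheory.arg_maxP _ _ _ ord0 xpredT (fun i => z i 0).
by exists i => j; exact: zi.
Qed.

Lemma exists_min_entry (n : nat) (z : 'cV[R]_n.+1) :
  exists i, forall j, z i 0 <= z j 0.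
Proof.
have [i zi] := exists_max_entry (- z); exists i => j.
by have := zi j; rewrite !mxE lerN2.
Qed.

Lemma int_contrast_b2 : int_contrast (b2 R).
Proof.
split; last by case: (b2_contrast R).
move=> j; rewrite mxE; case: j => -[|[|[|//]]] ? /=;
  by rewrite ?rpredN ?rpred1 ?rpred_nat.
Qed.

Lemma int_contrast_b11 : int_contrast (b11 R).
Proof.
split; last by case: (b11_contrast R).
by move=> j; rewrite mxE; case: j => -[|[|[|[|//]]]] ? /=; rewrite ?rpredN ?rpred1.
Qed.

(** If the middle entry were the largest, both differences in
    [(z_0 - z_1) + (z_2 - z_1)] would be nonpositive. *)
Lemma steerable_b2 : steerable (b2 R).
Proof.
move=> z; rewrite /Delta !big_ord_recl big_ord0 !mxE /= => Dgt0; left.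
have [i zi] := exists_max_entry z.
exists i => //; rewrite mxE; case: (unliftP ord0 i) zi => [j|] -> //.
case: (unliftP ord0 j) => [k|] -> //; first by rewrite (ord1 k).
by move=> zi; have := zi ord0; have := zi (lift ord0 (lift ord0 ord0)); lra.
Qed.

(** If neither move is available, a largest entry has weight [-1] and a
    smallest one weight [1]; pairing the largest entry with the other entry of
    weight [1], and the smallest with the other entry of weight [-1], writes
    [Delta z w] as a sum of two nonpositive differences. *)
Lemma steerable_b11 : steerable (b11 R).
Proof.
move=> z; rewrite /Delta !big_ord_recl big_ord0 !mxE /= => Dgt0.
have [i zi] := exists_max_entry z; have [l zl] := exists_min_entry z.
have [wi|wi] := eqVneq (b11 R i 0) 1; first by left; exists i.
have [wl|wl] := eqVneq (b11 R l 0) (-1); first by right; exists l.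
exfalso; pose o1 : 'I_4 := lift ord0 ord0.
pose o2 : 'I_4 := lift ord0 (lift ord0 ord0).
pose o3 : 'I_4 := lift ord0 (lift ord0 (lift ord0 ord0)).
rewrite -/o1 -/o2 -/o3 in Dgt0.
have {wi} zi_eq : z i 0 = z ord0 0 \/ z i 0 = z o3 0.
  move: wi; rewrite mxE; case: (unliftP ord0 i) => [i1|] ->; last by left.
  case: (unliftP ord0 i1) => [i2|] ->; last by rewrite /= eqxx.
  case: (unliftP ord0 i2) => [i3|] ->; last by rewrite /= eqxx.
  by right; rewrite (ord1 i3).
have {wl} zl_eq : z l 0 = z o1 0 \/ z l 0 = z o2 0.
  move: wl; rewrite mxE; case: (unliftP ord0 l) => [l1|] ->; last first.
    by rewrite /= eqxx.
  case: (unliftP ord0 l1) => [l2|] ->; last by left.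
  case: (unliftP ord0 l2) => [l3|] ->; last by right.
  by rewrite (ord1 l3) /= eqxx.
have := zi o1; have := zi o2; have := zl ord0; have := zl o3.
by case: zi_eq => ->; case: zl_eq => ->; lra.
Qed.

End CyclicDifference.

Theorem proposition2p5 (R : realType) :
  (forall x : 'cV[R]_3, (forall j, - pi <= x j 0 < pi) ->
    [/\ is_min (cyc_values x (b2 R)) (cyc_diff x (b2 R)),
        is_min [set `|Delta x (b2 R) + 2 * pi * k%:~R| | k in [set: int]]
               (cyc_diff x (b2 R))
      & cyc_diff x (b2 R) = `|pmod2pi (Delta x (b2 R))| ])
  /\
  (forall x : 'cV[R]_4, (forall j, - pi <= x j 0 < pi) ->
    [/\ is_min (cyc_values x (b11 R)) (cyc_diff x (b11 R)),
        is_min [set `|Delta x (b11 R) + 2 * pi * k%:~R| | k in [set: int]]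
               (cyc_diff x (b11 R))
      & cyc_diff x (b11 R) = `|pmod2pi (Delta x (b11 R))| ]).
Proof.
split=> x; apply: cyc_diff_steerable.
- exact: int_contrast_b2.
- exact: steerable_b2.
- exact: int_contrast_b11.
- exact: steerable_b11.
Qed.
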